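(* Let $\{\alpha,\beta\} \in \{\{132,213\},\ \{231,312\}\}$. Then $s_n(\emptyset;\{\alpha,\beta\}) = (n^2+21n-28)\,2^{n-9}$ for all integers $n \geq 7$, and $s_6(\emptyset;\{\alpha,\beta\})=17$, $s_5(\emptyset;\{\alpha,\beta\})=6$, and $s_4(\emptyset;\{\alpha,\beta\})=3$.
   Context: Let $S_n$ denote the set of permutations of $[n]=\{1,2,\dots,n\}$, written as words $\pi=\pi_1\pi_2\cdots\pi_n$. For a pattern $\alpha=\alpha_1\cdots\alpha_k \in S_k$ with $k \le n$, an occurrence of $\alpha$ in $\pi \in S_n$ is a choice of indices $i_1<i_2<\cdots<i_k$ such that $\pi_{i_1}\pi_{i_2}\cdots\pi_{i_k}$ is order-isomorphic to $\alpha$, i.e. $|\{m \in \{1,\dots,k\} : \pi_{i_m} \le \pi_{i_j}\}| = \alpha_j$ for every $j=1,\dots,k$. A permutation contains $\alpha$ exactly once if it has exactly one occurrence of $\alpha$. Patterns such as $132$ or $312$ are elements of $S_3$ written as words. For patterns $\alpha \neq \beta$ in $S_3$, $s_n(\emptyset;\{\alpha,\beta\})$ denotes the number of permutations $\pi \in S_n$ that contain exactly one occurrence of $\alpha$ and exactly one occurrence of $\beta$ (the symbol $\emptyset$ indicates that no pattern is required to be avoided). *)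

(* Defs.v *)
From mathcomp Require Import all_boot all_order all_fingroup all_algebra.
Set Implicit Arguments.
Unset Strict Implicit.
Unset Printing Implicit Defensive.

(* Permutations of [n] are elements of 'S_n, acting on {0, ..., n-1}; the
   letter pi_(i+1) of the word is (pi i).+1. *)
Definition word (n : nat) (p : 'S_n) : seq nat := [seq (p i).+1 | i <- enum 'I_n].

(* f j is the position of the j-th letter of the occurrence.  The relative
   rank of that letter counts the letter itself, so it is alpha_(j+1), i.e.
   (alpha j).+1. *)
Definition occurrence (k n : nat) (alpha : 'S_k) (p : 'S_n)
    (f : {ffun 'I_k -> 'I_n}) : bool :=
  [forall i : 'I_k, forall j : 'I_k, (i < j) ==> (f i < f j)] &&
  [forall j : 'I_k, #|[set m : 'I_k | p (f m) <= p (f j)]| == (alpha j).+1].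

Definition occurrences (k n : nat) (alpha : 'S_k) (p : 'S_n) : nat :=
  #|[set f : {ffun 'I_k -> 'I_n} | occurrence alpha p f]|.

(* s_n(A; E): permutations avoiding every pattern of A and containing every
   pattern of E exactly once. *)
Definition avoid_once_count (k n : nat) (A E : {set 'S_k}) : nat :=
  #|[set p : 'S_n | [forall a in A, occurrences a p == 0] &&
                    [forall b in E, occurrences b p == 1]]|.

Definition pat132 : 'S_3 := tperm (inord 1) (inord 2).
Definition pat213 : 'S_3 := tperm (inord 0) (inord 1).
Definition pat231 : 'S_3 :=
  (tperm (inord 0) (inord 1) * tperm (inord 0) (inord 2))%g.
Definition pat312 : 'S_3 :=
  (tperm (inord 0) (inord 2) * tperm (inord 0) (inord 1))%g.

Lemma word_pat132 : word pat132 = [:: 1; 3; 2].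
Proof.
by rewrite /word !enum_ordSl enum_ord0 /= !permE /=
  -!val_eqE /= !inordK.
Qed.

Lemma word_pat213 : word pat213 = [:: 2; 1; 3].
Proof.
by rewrite /word !enum_ordSl enum_ord0 /= !permE /=
  -!val_eqE /= !inordK.
Qed.

Lemma word_pat231 : word pat231 = [:: 2; 3; 1].
Proof.
by rewrite /word !enum_ordSl enum_ord0 /= !permM !permE /=
  -!val_eqE /= !inordK //= !permE /= -!val_eqE /= !inordK.
Qed.

Lemma word_pat312 : word pat312 = [:: 3; 1; 2].
Proof.
by rewrite /word !enum_ordSl enum_ord0 /= !permM !permE /=
  -!val_eqE /= !inordK //= !permE /= -!val_eqE /= !inordK.
Qed.

(* Main.v *)
Require Import Defs.
From mathcomp Require Import all_boot all_order all_fingroup all_algebra.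
From mathcomp Require Import zify ring.
Import GRing.Theory Num.Theory.
Set Implicit Arguments.
Unset Strict Implicit.
Unset Printing Implicit Defensive.

(** Reversing words exchanges the pairs 132, 213 and 231, 312, so it suffices to
    treat the first pair.

    The patterns 132 and 213 are skew-indecomposable.  If a permutation is a skew
    sum, that is, a concatenation of blocks whose letters are all larger than the
    letters of the later blocks, then each occurrence of 132 or of 213 lies inside
    a block and the numbers of occurrences add up ([t132_skew_sum],
    [t213_skew_sum]).  Inspecting what can follow the first letter shows that, in
    a permutation with at most one occurrence of each, the first indecomposable
    block is either increasing or one of 132, 213, 1324, 2413, 3142, the last
    three having one occurrence of both patterns ([first_block_shape]).  Such a
    decomposition is unique ([skew_sum_inj]).

    Let N(a, b, n), which is [num_words a b n], be the number of words of length
    n with a occurrences of 132 and b of 213, where a and b are 0 or 1.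
    Splitting off the first block gives

      N(a, b, n) = N(a, b, 0) + ... + N(a, b, n-1) + E(a, b, n),

    where E, which is [exceptional_num_words], collects the exceptional blocks:

      E(0, 0, n) = 0,   E(1, 0, n) = E(0, 1, n) = N(0, 0, n-3),
      E(1, 1, n) = N(0, 1, n-3) + N(1, 0, n-3) + 3 N(0, 0, n-4).

    Differences of consecutive instances turn this into
    N(a, b, n+1) = 2 N(a, b, n) + E(a, b, n+1) - E(a, b, n), which is solved by
    N(0, 0, n) = 2^(n-1) for n >= 1, by N(1, 0, n) = N(0, 1, n) = n 2^(n-5) for
    n >= 4, and by the stated values of N(1, 1, n). *)

(** * Counting triples of letters in a word *)

Section TripleCount.
Variable T : eqType.
Implicit Types (R : rel T) (P : T -> rel T) (s t : seq T).

Fixpoint pair_count R s :=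
  if s is x :: s' then count (R x) s' + pair_count R s' else 0.

Fixpoint triple_count P s :=
  if s is x :: s' then pair_count (P x) s' + triple_count P s' else 0.

Lemma pair_count_cat R s t : pair_count R (s ++ t) =
  pair_count R s + pair_count R t + \sum_(x <- s) count (R x) t.
Proof.
elim: s => [|x s IHs] /=; first by rewrite big_nil addn0.
rewrite IHs big_cons count_cat; lia.
Qed.

Lemma pair_count_cat0 R s t : {in s & t, forall x y, ~~ R x y} ->
  pair_count R (s ++ t) = pair_count R s + pair_count R t.
Proof.
move=> Rst; rewrite pair_count_cat big1_seq ?addn0 // => x /andP[_ xs].
by apply/eqP; rewrite -leqn0 leqNgt -has_count; apply/hasPn => y; apply: Rst.
Qed.

Lemma pair_count0 R s : {in s &, forall x y, ~~ R x y} -> pair_count R s = 0.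
Proof.
elim: s => //= x s IHs Rs; rewrite IHs => [|y z ys zs]; last first.
  by apply: Rs; rewrite inE ?ys ?zs orbT.
apply/eqP; rewrite addn0 -leqn0 leqNgt -has_count; apply/hasPn => y ys.
by apply: Rs; rewrite inE ?eqxx ?ys ?orbT.
Qed.

(** The hypothesis does not ask where [y] lies because a triple straddling the cut
    may have its middle letter on either side. *)
Lemma triple_count_cat0 P s t :
    (forall x y z, x \in s -> z \in t -> ~~ P x y z) ->
  triple_count P (s ++ t) = triple_count P s + triple_count P t.
Proof.
elim: s => //= x s IHs Pst; rewrite IHs => [|y u z ys zt]; last first.
  by apply: Pst; rewrite ?inE ?ys ?orbT.
rewrite pair_count_cat0 => [|y z _ zt]; last by apply: Pst; rewrite ?mem_head.
rewrite [pair_count _ t]pair_count0 ?addn0 ?addnA // => y z _ zt.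
by apply: Pst; rewrite ?mem_head.
Qed.

Lemma pair_count_subseq R s t : subseq s t -> pair_count R s <= pair_count R t.
Proof.
elim: t s => [|y t IHt] [|x s] //=; case: eqP => [-> st|_ /IHt /= le_st].
  by rewrite leq_add ?IHt // leq_count_subseq.
exact: leq_trans le_st (leq_addl _ _).
Qed.

Lemma triple_count_subseq P s t :
  subseq s t -> triple_count P s <= triple_count P t.
Proof.
elim: t s => [|y t IHt] [|x s] //=; case: eqP => [-> st|_ /IHt /= le_st].
  by rewrite leq_add ?IHt // pair_count_subseq.
exact: leq_trans le_st (leq_addl _ _).
Qed.

Lemma eq_pair_count R R' s : R =2 R' -> pair_count R s = pair_count R' s.
Proof. by move=> eqR; elim: s => //= x s ->; rewrite (eq_count (eqR x)). Qed.

Lemma eq_triple_count P P' s : (forall x, P x =2 P' x) ->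
  triple_count P s = triple_count P' s.
Proof.
by move=> eqP; elim: s => //= x s ->; rewrite (eq_pair_count _ (eqP x)).
Qed.

Lemma pair_count_rcons R s x :
  pair_count R (rcons s x) = pair_count R s + count (R^~ x) s.
Proof.
by elim: s => //= y s ->; rewrite -cats1 count_cat /=; lia.
Qed.

Lemma triple_count_rcons P s x : triple_count P (rcons s x) =
  triple_count P s + pair_count (fun y z => P y z x) s.
Proof. by elim: s => //= y s ->; rewrite pair_count_rcons; lia. Qed.

Lemma pair_count_rev R s : pair_count R (rev s) = pair_count (fun x y => R y x) s.
Proof.
by elim: s => //= x s IHs; rewrite rev_cons pair_count_rcons IHs count_rev addnC.
Qed.

Lemma triple_count_rev P s :
  triple_count P (rev s) = triple_count (fun x y z => P z y x) s.
Proof.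
elim: s => //= x s IHs.
by rewrite rev_cons triple_count_rcons IHs pair_count_rev addnC.
Qed.

End TripleCount.

Lemma pair_count_map (T U : eqType) (f : T -> U) (R : rel U) s :
  pair_count R (map f s) = pair_count (fun x y => R (f x) (f y)) s.
Proof. by elim: s => //= x s ->; rewrite count_map. Qed.

Lemma triple_count_map (T U : eqType) (f : T -> U) (P : U -> rel U) s :
  triple_count P (map f s) = triple_count (fun x y z => P (f x) (f y) (f z)) s.
Proof. by elim: s => //= x s ->; rewrite pair_count_map. Qed.

(** * Skew sums of blocks *)

Definition is132 a b c := a < c < b.
Definition is213 a b c := b < a < c.
Notation t132 := (triple_count is132).
Notation t213 := (triple_count is213).

(** Only [size v] matters for the shift because [v] is meant to be a rearrangement
    of [1 .. size v]; then every letter of the lifted [u] exceeds all of [v]. *)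
Definition skew_sum (u v : seq nat) := map (addn (size v)) u ++ v.

(** The skew-indecomposable words, other than increasing ones, with at most one
    132 and at most one 213. *)
Definition exceptional_blocks : seq (seq nat) :=
  [:: [:: 1; 3; 2]; [:: 2; 1; 3];
      [:: 1; 3; 2; 4]; [:: 2; 4; 1; 3]; [:: 3; 1; 4; 2]].

Definition blocks n : seq (seq nat) :=
  [seq iota 1 k | k <- iota 1 n] ++ [seq B <- exceptional_blocks | size B <= n].

Lemma skew_sum_gt u v x z : perm_eq v (iota 1 (size v)) ->
  {in u, forall i, 0 < i} ->
  x \in map (addn (size v)) u -> z \in v -> z < x.
Proof.
move=> pv u_gt0 /mapP[i iu ->]; rewrite (perm_mem pv) mem_iota.
by have := u_gt0 i iu; lia.
Qed.

(** In both patterns the first letter is smaller than the last one, so a triple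
    cannot start in the upper part and end in the lower part of a skew sum. *)
Lemma t132_skew_sum u v : perm_eq v (iota 1 (size v)) ->
  {in u, forall i, 0 < i} -> t132 (skew_sum u v) = t132 u + t132 v.
Proof.
move=> pv u_gt0; rewrite triple_count_cat0 => [|x y z xu zv].
  rewrite triple_count_map; congr (_ + _); apply: eq_triple_count => x y z.
  by rewrite /is132 !ltn_add2l.
have := skew_sum_gt pv u_gt0 xu zv; rewrite /is132; lia.
Qed.

Lemma t213_skew_sum u v : perm_eq v (iota 1 (size v)) ->
  {in u, forall i, 0 < i} -> t213 (skew_sum u v) = t213 u + t213 v.
Proof.
move=> pv u_gt0; rewrite triple_count_cat0 => [|x y z xu zv].
  rewrite triple_count_map; congr (_ + _); apply: eq_triple_count => x y z.
  by rewrite /is213 !ltn_add2l.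
have := skew_sum_gt pv u_gt0 xu zv; rewrite /is213; lia.
Qed.

Lemma perm_skew_sum u v : perm_eq u (iota 1 (size u)) ->
  perm_eq v (iota 1 (size v)) ->
  perm_eq (skew_sum u v) (iota 1 (size u + size v)).
Proof.
move=> pu pv; rewrite addnC iotaD iotaDl perm_sym perm_catC perm_sym.
rewrite perm_cat //.
rewrite -[X in perm_eq _ X](_ : map (addn (size v)) (iota 1 (size u)) = _).
  exact: perm_map.
by rewrite -iotaDl -iotaDl addnC.
Qed.

Lemma triple_count_iota m k :
  (t132 (iota m k) = 0) * (t213 (iota m k) = 0).
Proof.
elim: k m => //= k IHk m; rewrite !IHk !addn0.
have: pairwise ltn (iota m.+1 k).
  by rewrite -(sorted_pairwise ltn_trans) iota_ltn_sorted.
have: all (ltn m) (iota m.+1 k) by apply/allP => i; rewrite mem_iota => /andP[].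
elim: (iota _ _) => //= x s IHs /andP[mx ms] /andP[xs {}/(IHs ms)[-> ->]].
rewrite !addn0; split; apply/eqP; rewrite -leqn0 leqNgt -has_count;
  apply/hasPn => y ys; have := allP xs y ys; rewrite /is132 /is213 /=;
  by move: mx => /=; lia.
Qed.

Lemma mem_blocks n B : B \in blocks n ->
  [/\ B != [::], size B <= n & perm_eq B (iota 1 (size B))].
Proof.
rewrite mem_cat mem_filter => /orP[/mapP[k]|/andP[-> ]].
  by rewrite mem_iota => kn ->; rewrite size_iota -size_eq0 size_iota; split=> //; lia.
by rewrite !inE => /or4P[/eqP->|/eqP->|/eqP->|/orP[]/eqP->].
Qed.

(** * The first block of a word *)

Lemma prefix_split (T : Type) (a : pred T) s :
  all a s \/ exists s1 y s2, [/\ s = s1 ++ y :: s2, all a s1 & ~~ a y].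
Proof.
elim: s => [|x s IHs]; first by left.
case ax: (a x); last by right; exists [::], x, s; rewrite /= ax.
case: IHs => [alls|[s1 [y [s2 [-> as1 ay]]]]]; first by left; rewrite /= ax.
by right; exists (x :: s1), y, s2; rewrite /= ax.
Qed.

Lemma descent_split s : sorted ltn s \/
  exists s1 a b s2, s = s1 ++ a :: b :: s2 /\ b <= a.
Proof.
elim: s => [|x [|y s] IHs]; [by left | by left |].
case: (ltnP x y) => xy; last by right; exists [::], x, y, s.
case: IHs => [ss|[s1 [a [b [s2 [-> ab]]]]]]; first by left; rewrite /= xy.
by right; exists (x :: s1), a, b, s2.
Qed.

(** The word order-isomorphic to [B] on the letters of the increasing list [S]. *)
Definition relabel (S B : seq nat) := [seq nth 0 S i.-1 | i <- B].

Lemma relabel_iota S : relabel S (iota 1 (size S)) = S.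
Proof.
apply: (@eq_from_nth _ 0); rewrite size_map size_iota // => i iS.
by rewrite (nth_map 0) ?size_iota // nth_iota.
Qed.

Definition is_block B := (B == iota 1 (size B)) || (B \in exceptional_blocks).

Lemma subseq_cons2 (T : eqType) (x : T) s t :
  subseq s t -> subseq (x :: s) (x :: t).
Proof. by rewrite /= eqxx. Qed.

Lemma subseq_skip (T : eqType) (x : T) s t : subseq s t -> subseq s (x :: t).
Proof. by move/subseq_trans; apply; apply: subseq_cons. Qed.

Lemma subseq_skip_cat (T : eqType) (s t u : seq T) :
  subseq s u -> subseq s (t ++ u).
Proof. by move/subseq_trans; apply; apply: suffix_subseq. Qed.

Lemma mem_split (T : eqType) (x : T) s :
  x \in s -> exists s1 s2, s = s1 ++ x :: s2.
Proof. by case/splitPr => s1 s2; exists s1, s2. Qed.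

Ltac find_subseq := rewrite ?(=^~ catA, cat_cons);
  repeat first [apply: sub0seq | apply: subseq_cons2
               | apply: subseq_skip | apply: subseq_skip_cat].

(** The first letter [x] decides everything, since two letters above [x] in
    decreasing order complete a 132, and a letter below [x] followed by one above
    [x] completes a 213; at most one of each is available.  If all letters above
    [x] come first, they increase, which gives an increasing block, or have a
    single inversion.  The inversion must then be at their beginning, as an earlier
    letter would make a second 132, and at most one letter follows it, as each
    one makes a 213: the block is 132 or 1324.  Otherwise some [y < x] is
    immediately followed by [z > x], the last letter above [x].  At most one letter
    [t] stands between [x] and [y], giving 2413, and without it at most one letter
    between [y] and [x] in value follows [z], giving 213 or 3142. *)
Lemma first_block_shape x s : uniq (x :: s) ->
    t132 (x :: s) <= 1 -> t213 (x :: s) <= 1 ->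
  exists S B v, [/\ sorted ltn S, is_block B, size B = size S, B != [::] &
     x :: s = relabel S B ++ v /\ allrel ltn v S].
Proof.
move=> Uw le132 le213.
have sub132 q : subseq q (x :: s) -> uniq q /\ t132 q <= 1.
  by move=> sq; rewrite (subseq_uniq sq) ?(leq_trans (triple_count_subseq _ sq)).
have sub213 q : subseq q (x :: s) -> uniq q /\ t213 q <= 1.
  by move=> sq; rewrite (subseq_uniq sq) ?(leq_trans (triple_count_subseq _ sq)).
clear Uw le132 le213.
(* If the goal failed, the subword [q] would contain the pattern twice or a
   letter twice. *)
Local Ltac too_many H q :=
  have := H q ltac:(find_subseq);
  rewrite /= !inE /is132 /is213; lia.
(* The letters above [x] all precede those below it. *)
have increasing u v : s = u ++ v -> all (ltn x) u ->
    (forall z, z \in v -> z <= x) ->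
  exists S B v, [/\ sorted ltn S, is_block B, size B = size S, B != [::] &
     x :: s = relabel S B ++ v /\ allrel ltn v S].
  move=> Es xu vx; subst s.
  have {}vx z : z \in v -> z < x.
    move=> zv; have := vx z zv; have [p1 [p2 Ev]] := mem_split zv; subst v.
    too_many sub132 [:: x; z].
  case: (descent_split u) => [su|[s1 [a [b [s2 [Eu ba]]]]]]; last subst u.
    exists (x :: u), (iota 1 (size (x :: u))), v; split=> //.
    - by rewrite /= path_min_sorted.
    - by rewrite /is_block size_iota eqxx.
    - by rewrite size_iota.
    rewrite relabel_iota; split=> //; apply/allrelP => z y /vx zx.
    by rewrite inE => /predU1P[->//|/(allP xu)/=]; lia.
  destruct s1 as [|r s1]; last first.
    move: xu; rewrite /= all_cat /= => /and5P[xr _ xa xb _].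
    have [rb|rb] := ltnP r b; first too_many sub132 [:: x; r; a; b].
    too_many sub132 [:: x; r; a; b].
  move: xu => /= /and3P[xa xb xs2].
  have as2 c : c \in s2 -> a < c.
    move=> cs2; have := allP xs2 c cs2.
    have [p1 [p2 Es2]] := mem_split cs2; subst s2.
    too_many sub132 [:: x; a; b; c].
  have {}ba : b < a by too_many sub132 [:: x; a; b].
  destruct s2 as [|c [|d s2]].
  - exists [:: x; b; a], [:: 1; 3; 2], v; split=> //=; first by rewrite xb ba.
    split=> //; apply/allrelP => z y /vx zx; rewrite !inE; lia.
  - exists [:: x; b; a; c], [:: 1; 3; 2; 4], v; split=> //=.
      by rewrite xb ba as2 ?mem_head.
    have := as2 c (mem_head _ _).
    split=> //; apply/allrelP => z y /vx zx; rewrite !inE; lia.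
  have ac : a < c by rewrite as2 ?inE ?eqxx.
  have ad : a < d by rewrite as2 ?inE ?eqxx ?orbT.
  too_many sub213 [:: a; b; c; d].
have [xs|[u [y [v [Es ux nxy]]]]] := prefix_split (ltn x) s.
  by apply: (increasing s [::]); rewrite ?cats0.
have [vx|[v1 [z [v2 [Ev v1x]]]]] := prefix_split (fun z => ~~ (x < z)) v.
  apply: increasing Es ux _ => z; rewrite inE leqNgt.
  by move=> /predU1P[->//|/(allP vx)].
(* From here on a letter [y] below [x] precedes a letter [z] above it. *)
rewrite negbK => xz; clear increasing; subst s v.
have yx : y < x by move: nxy => /=; too_many sub132 [:: x; y].
destruct v1 as [|y' v1]; last first.
  case/andP: v1x => y'x _; too_many sub213 [:: x; y; y'; z].
have v2x c : c \in v2 -> c < x.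
  move=> cv2; have [p1 [p2 Ev2]] := mem_split cv2; subst v2.
  too_many sub213 [:: x; y; z; c].
have uz t : t \in u -> z < t.
  move=> tu; have /= := allP ux t tu.
  have [p1 [p2 Eu]] := mem_split tu; subst u.
  too_many sub213 [:: x; t; y; z].
destruct u as [|t [|t2 u]]; last first.
- have tz : z < t by rewrite uz ?inE ?eqxx.
  have t2z : z < t2 by rewrite uz ?inE ?eqxx ?orbT.
  too_many sub132 [:: x; t; t2; z].
- have zt : z < t by rewrite uz ?inE ?eqxx.
  exists [:: y; x; z; t], [:: 2; 4; 1; 3], v2; split=> //=; first by lia.
  split=> //; apply/allrelP => c d cv2.
  have {cv2} cy : c < y.
    have := v2x c cv2; have [p1 [p2 Ev2]] := mem_split cv2; subst v2.
    too_many sub132 [:: x; t; y; z; c].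
  by rewrite !inE; lia.
have [v2y|[r [t [r' [Ev2 ry]]]]] := prefix_split (fun t => ~~ (y < t)) v2.
  exists [:: y; x; z], [:: 2; 1; 3], v2; split=> //=; first by lia.
  split=> //; apply/allrelP => c d cv2.
  have {cv2} cy : c < y.
    have := allP v2y c cv2; have [p1 [p2 Ev2]] := mem_split cv2; subst v2.
    too_many sub132 [:: y; c].
  by rewrite !inE; lia.
rewrite negbK => yt; subst v2.
have tx : t < x by apply: v2x; rewrite mem_cat mem_head orbT.
destruct r as [|r0 r]; last first.
  case/andP: ry => r0y _; too_many sub213 [:: x; y; z; r0; t].
exists [:: y; t; x; z], [:: 3; 1; 4; 2], r'; split=> //=; first by lia.
split=> //; apply/allrelP => c d cr'.
have {cr'} cy : c < y.
  have := v2x c; have [p1 [p2 Er']] := mem_split cr'; subst r'.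
  rewrite inE mem_cat mem_head !orbT => /(_ isT).
  too_many sub132 [:: y; z; t; c].
by rewrite !inE; lia.
Qed.

Lemma perm_iota_eq S m k : sorted ltn S -> perm_eq S (iota m k) -> S = iota m k.
Proof.
move=> sS /perm_mem; apply: (irr_sorted_eq ltn_trans ltnn sS).
exact: iota_ltn_sorted.
Qed.

Lemma is_block_perm B : is_block B -> perm_eq B (iota 1 (size B)).
Proof.
case/orP => [/eqP{1}->//|]; rewrite !inE.
by move=> /or4P[/eqP->|/eqP->|/eqP->|/orP[]/eqP->].
Qed.

Lemma relabel_perm S B : size B = size S -> is_block B ->
  perm_eq (relabel S B) S.
Proof.
move=> sBS /is_block_perm; rewrite sBS => /(perm_map (fun i => nth 0 S i.-1)).
by rewrite -/(relabel _ _) -/(relabel _ _) relabel_iota.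
Qed.

(** Sorting both parts of a skew-decomposed permutation yields [1 .. n]. *)
Lemma perm_cat_iota (v S : seq nat) n : perm_eq (v ++ S) (iota 1 n) ->
    allrel ltn v S ->
  perm_eq v (iota 1 (size v)) /\ perm_eq S (iota (size v).+1 (size S)).
Proof.
move=> pvS ltvS.
have szn : n = size v + size S by rewrite -size_cat (perm_size pvS) size_iota.
have sorted_cat : sort leq v ++ sort leq S = iota 1 n.
  apply: (sorted_eq leq_trans anti_leq).
  - rewrite (sorted_pairwise leq_trans) pairwise_cat.
    rewrite -!(sorted_pairwise leq_trans) !(sort_sorted leq_total) !andbT.
    apply/allrelP => a b; rewrite !mem_sort => av bS.
    exact: ltnW (allrelP ltvS a b av bS).
  - exact: iota_sorted.
  - by rewrite (perm_trans _ pvS) // perm_cat // perm_sort.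
move/eqP: sorted_cat; rewrite szn iotaD eqseq_cat ?size_sort ?size_iota // add1n.
by case/andP => /eqP<- /eqP<-; rewrite ![perm_eq _ (sort _ _)]perm_sym !perm_sort.
Qed.

Lemma blocksE n B : is_block B -> B != [::] -> size B <= n -> B \in blocks n.
Proof.
rewrite /is_block mem_cat mem_filter => /orP[/eqP-> B0 Bn|-> _ ->]; last first.
  by rewrite orbT.
apply/orP; left; apply/mapP; exists (size B); rewrite // mem_iota.
by move: B0 Bn; rewrite size_iota -size_eq0 size_iota; lia.
Qed.

Lemma first_block n w : perm_eq w (iota 1 n.+1) -> t132 w <= 1 -> t213 w <= 1 ->
  exists B v, [/\ B \in blocks n.+1, perm_eq v (iota 1 (n.+1 - size B)) &
                 w = skew_sum B v].
Proof.
move=> pw; have sw := perm_size pw.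
have: uniq w by rewrite (perm_uniq pw) iota_uniq.
case: w pw sw => [//|x s] pw sw Uw le132 le213.
have [S [B [v [sS bB sBS B0 [Ew ltvS]]]]] := first_block_shape Uw le132 le213.
have pBS := relabel_perm sBS bB.
have pvS : perm_eq (v ++ S) (iota 1 n.+1).
  by rewrite (perm_trans _ pw) // Ew perm_catC perm_cat2r perm_sym.
have szn : size v + size B = n.+1.
  by rewrite sBS -size_cat (perm_size pvS) size_iota.
have [pv /(perm_iota_eq sS) ES] := perm_cat_iota pvS ltvS.
exists B, v; split.
- by rewrite blocksE // -szn leq_addl.
- by rewrite -szn addnK.
rewrite Ew /skew_sum; congr (_ ++ _); rewrite /relabel ES -sBS.
apply/eq_in_map => i; rewrite (perm_mem (is_block_perm bB)) mem_iota => Bi.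
by rewrite nth_iota; lia.
Qed.

(** * Unique decomposition *)

Definition indecomposable (B : seq nat) :=
  forall C D, B = C ++ D -> C != [::] -> D != [::] -> ~~ allrel ltn D C.

Lemma blocks_indecomposable n B : B \in blocks n -> indecomposable B.
Proof.
rewrite mem_cat mem_filter => /orP[/mapP[k _ ->]|/andP[_ exB]] C D EB C0 D0.
  apply/negP => /allrelP ltDC; move: (iota_ltn_sorted 1 k).
  rewrite EB (sorted_pairwise ltn_trans) pairwise_cat => /and3P[/allrelP ltCD _ _].
  case: C C0 ltDC ltCD {EB} => // c C _; case: D D0 => // d D _ ltDC ltCD.
  by have := ltDC d c; have := ltCD c d; rewrite !mem_head /=; lia.
have: all (fun B => all (fun i => ~~ allrel ltn (drop i B) (take i B))
  (iota 1 (size B).-1)) exceptional_blocks by [].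
move=> /allP/(_ B exB)/allP/(_ (size C)).
rewrite EB take_size_cat // drop_size_cat //.
apply; rewrite mem_iota size_cat.
by case: C C0 {EB} => // c C _; case: D D0 => // d D _ /=; lia.
Qed.

(** If the first block of one decomposition were shorter, the other one would
    split along it into a higher and a lower part. *)
Lemma skew_sum_inj n B v B' v' : B \in blocks n -> B' \in blocks n ->
    perm_eq v (iota 1 (n - size B)) -> perm_eq v' (iota 1 (n - size B')) ->
  skew_sum B v = skew_sum B' v' -> B = B' /\ v = v'.
Proof.
wlog leBB' : B v B' v' / size B <= size B' => [hwlog|].
  have [|/ltnW] := leqP (size B) (size B'); first exact: hwlog.
  by move=> le bB bB' pv pv' /esym E; have [-> ->] := hwlog _ _ _ _ le bB' bB pv' pv E.
move=> bB bB' pv pv' E.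
have [B0 Bn pB] := mem_blocks bB; have [B'0 B'n pB'] := mem_blocks bB'.
have sv : size v = n - size B by rewrite (perm_size pv) size_iota.
have sv' : size v' = n - size B' by rewrite (perm_size pv') size_iota.
have addIm m : injective (map (addn m)) by apply: inj_map; apply: addnI.
move: leBB'; rewrite leq_eqVlt => /predU1P[eBB'|ltBB'].
  move/eqP: E; rewrite /skew_sum eqseq_cat ?size_map // sv sv' -eBB'.
  by case/andP => /eqP/addIm-> /eqP->.
have pw' : perm_eq v (iota 1 (size v)) by rewrite sv.
have /negP[] : ~~ allrel ltn (drop (size B) B') (take (size B) B').
  apply: (blocks_indecomposable bB'); rewrite ?cat_take_drop //.
    by rewrite -size_eq0 size_takel ?size_eq0 // ltnW.
  by rewrite -size_eq0 size_drop; lia.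
have Etake : map (addn (size v')) (take (size B) B') = map (addn (size v)) B.
  rewrite map_take -(@take_size_cat _ (size B) (map _ B) v) ?size_map //.
  by rewrite -/(skew_sum _ _) E /skew_sum take_cat size_map ltBB'.
have Edrop : map (addn (size v')) (drop (size B) B') ++ v' = v.
  rewrite map_drop -(@drop_size_cat _ (size B) (map (addn (size v)) B) v) ?size_map //.
  by rewrite -/(skew_sum _ _) E /skew_sum drop_cat size_map ltBB'.
apply/allrelP => d c dD cC; rewrite /= -(ltn_add2l (size v')).
apply: (@skew_sum_gt B v) => //.
- by move=> i; rewrite (perm_mem pB) mem_iota => /andP[].
- by rewrite -Etake map_f.
- by rewrite -Edrop mem_cat map_f.
Qed.

(** * The recurrence and its solution *)

Definition words_with a b n :=
  [seq w <- permutations (iota 1 n) | (t132 w == a) && (t213 w == b)].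

Lemma mem_words_with a b n w : w \in words_with a b n =
  [&& t132 w == a, t213 w == b & perm_eq w (iota 1 n)].
Proof. by rewrite mem_filter mem_permutations andbA. Qed.

Lemma words_with_uniq a b n : uniq (words_with a b n).
Proof. exact/filter_uniq/permutations_uniq. Qed.

(** Splitting off the first block is a bijection; the pattern counts being
    additive, the remainder must have what the block leaves over. *)
Lemma words_with_rec a b n : a <= 1 -> b <= 1 ->
  perm_eq (words_with a b n.+1)
    [seq skew_sum B v |
       B <- [seq B <- blocks n.+1 | (t132 B <= a) && (t213 B <= b)],
       v <- words_with (a - t132 B) (b - t213 B) (n.+1 - size B)].
Proof.
move=> a1 b1; apply: uniq_perm; first exact: words_with_uniq.
  apply: allpairs_uniq_dep => [|B _|].
  - apply: filter_uniq; rewrite cat_uniq map_inj_uniq ?iota_uniq ?filter_uniq //.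
      rewrite andbT; apply/hasPn => B; rewrite mem_filter => /andP[_ exB].
      apply/mapP => -[k _]; move: exB; rewrite !inE.
      by move=> /or4P[/eqP->|/eqP->|/eqP->|/orP[]/eqP->];
        case: k => [|[|[|[|k]]]].
    by move=> i j /(congr1 size); rewrite !size_iota.
  - exact: words_with_uniq.
  move=> _ _ /allpairsPdep[B [v [+ + ->]]] /allpairsPdep[B' [v' [+ + ->]]] /=.
  rewrite !mem_filter !mem_permutations.
  move=> /andP[_ bB] /andP[_ pv] /andP[_ bB'] /andP[_ pv'].
  by move=> /(skew_sum_inj bB bB' pv pv')[-> ->].
move=> w; rewrite mem_words_with; apply/idP/allpairsPdep.
  case/and3P=> /eqP wa /eqP wb pw.
  have [||B [v [bB pv Ew]]] := first_block pw; rewrite ?wa ?wb //.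
  have [_ _ pB] := mem_blocks bB.
  have B_gt0 i : i \in B -> 0 < i by rewrite (perm_mem pB) mem_iota => /andP[].
  have pv' : perm_eq v (iota 1 (size v)).
    by rewrite (perm_size pv) size_iota.
  exists B, v; rewrite mem_filter bB mem_words_with pv andbT.
  move: wa wb; rewrite Ew t132_skew_sum // t213_skew_sum // => <- <-.
  by rewrite !leq_addr !addKn !eqxx.
move=> [B [v []]]; rewrite mem_filter mem_words_with => /andP[/andP[Ba Bb] bB].
move=> /and3P[/eqP va /eqP vb pv] ->.
have [_ Bn pB] := mem_blocks bB.
have B_gt0 i : i \in B -> 0 < i by rewrite (perm_mem pB) mem_iota => /andP[].
have pv' : perm_eq v (iota 1 (size v)) by rewrite (perm_size pv) size_iota.
rewrite t132_skew_sum // t213_skew_sum // va vb !subnKC // !eqxx /=.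
by have := perm_skew_sum pB pv'; rewrite (perm_size pv) size_iota subnKC.
Qed.

Definition num_words a b n := size (words_with a b n).

Definition exceptional_num_words a b n :=
  sumn [seq num_words (a - t132 B) (b - t213 B) (n - size B) |
    B <- [seq B <- exceptional_blocks |
           [&& size B <= n, t132 B <= a & t213 B <= b]]].

(** The sum collects the increasing first blocks, one for each length. *)
Lemma num_words_rec a b n : a <= 1 -> b <= 1 ->
  num_words a b n.+1 =
    \sum_(i < n.+1) num_words a b i + exceptional_num_words a b n.+1.
Proof.
move=> a1 b1; rewrite /num_words (perm_size (words_with_rec n a1 b1)).
rewrite size_allpairs_dep filter_cat map_cat sumn_cat -filter_predI.
congr (_ + _); last first.
  by congr (sumn (map _ _)); apply: eq_filter => B /=; rewrite [RHS]andbC.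
rewrite filter_map -map_comp.
rewrite (eq_filter (_ : _ =1 predT)) ?filter_predT; last first.
  by move=> k /=; rewrite !triple_count_iota.
rewrite (eq_map (_ : _ =1 fun k => num_words a b (n.+1 - k))); last first.
  by move=> k /=; rewrite !triple_count_iota size_iota !subn0.
rewrite sumnE big_map -[iota 1 n.+1]/(index_iota 1 n.+2) big_nat_rev big_add1 /=.
rewrite big_mkord; apply: eq_bigr => i _; rewrite /num_words.
by congr (size (words_with _ _ _)); have := ltn_ord i; lia.
Qed.

(** Subtracting two consecutive recurrences removes the sum; the terms are moved
    across so that no truncated subtraction appears. *)
Lemma num_words_step a b n : a <= 1 -> b <= 1 ->
  num_words a b n.+2 + exceptional_num_words a b n.+1 =
    2 * num_words a b n.+1 + exceptional_num_words a b n.+2.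
Proof.
move=> a1 b1; rewrite (num_words_rec n.+1) // big_ord_recr /=.
have := num_words_rec n a1 b1.
by move: (\sum_(i < _) _) => s; lia.
Qed.

Lemma exceptional_num_words00 n : exceptional_num_words 0 0 n = 0.
Proof. by rewrite /exceptional_num_words /= !andbF. Qed.

Lemma exceptional_num_words10 n : exceptional_num_words 1 0 n.+3 = num_words 0 0 n.
Proof. by rewrite /exceptional_num_words /= !andbF /= !subSS subn0 addn0. Qed.

Lemma exceptional_num_words01 n : exceptional_num_words 0 1 n.+3 = num_words 0 0 n.
Proof. by rewrite /exceptional_num_words /= !andbF /= !subSS subn0 addn0. Qed.

Lemma exceptional_num_words11 n :
  exceptional_num_words 1 1 n.+4 =
    num_words 0 1 n.+1 + num_words 1 0 n.+1 + 3 * num_words 0 0 n.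
Proof.
by rewrite /exceptional_num_words /= !subSS !subn0 addn0; lia.
Qed.

Lemma num_words00 n : num_words 0 0 n.+1 = 2 ^ n.
Proof.
elim: n => [|n IHn]; first by [].
have := @num_words_step 0 0 n isT isT; rewrite !exceptional_num_words00 IHn expnS; lia.
Qed.

(** The number of words is [n.+4 * 2 ^ (n - 1)]; doubling avoids a negative
    exponent. *)
Lemma num_words10 n : 2 * num_words 1 0 n.+4 = n.+4 * 2 ^ n.
Proof.
elim: n => [|n IHn]; first by vm_compute.
have := @num_words_step 1 0 n.+3 isT isT.
rewrite !exceptional_num_words10 !num_words00 !expnS; lia.
Qed.

Lemma num_words01 n : 2 * num_words 0 1 n.+4 = n.+4 * 2 ^ n.
Proof.
elim: n => [|n IHn]; first by vm_compute.
have := @num_words_step 0 1 n.+3 isT isT.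
rewrite !exceptional_num_words01 !num_words00 !expnS; lia.
Qed.

Lemma num_words11_small : [/\ num_words 1 1 4 = 3, num_words 1 1 5 = 6,
  num_words 1 1 6 = 17 & num_words 1 1 7 = 42].
Proof.
have n4 : num_words 1 1 4 = 3 by vm_compute.
have [] : [/\ num_words 0 1 1 = 0, num_words 0 1 2 = 0, num_words 0 1 3 = 1
  & num_words 0 1 4 = 2] by vm_compute.
have [] : [/\ num_words 1 0 1 = 0, num_words 1 0 2 = 0, num_words 1 0 3 = 1
  & num_words 1 0 4 = 2] by vm_compute.
have := num_words00 0; have := num_words00 1; have := num_words00 2.
have: num_words 0 0 0 = 1 by [].
have := @num_words_step 1 1 3 isT isT; have := @num_words_step 1 1 4 isT isT.
have := @num_words_step 1 1 5 isT isT; rewrite !exceptional_num_words11 n4.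
by split; lia.
Qed.

Lemma num_words11 n : 4 * num_words 1 1 n.+3.+4 + 28 * 2 ^ n =
  (n.+3.+4 ^ 2 + 21 * n.+3.+4) * 2 ^ n.
Proof.
rewrite -mulnn; elim: n => [|n IHn]; first by have [_ _ _ ->] := num_words11_small.
have := @num_words_step 1 1 n.+2.+4 isT isT.
have := num_words10 n; have := num_words01 n.
have := num_words10 n.+1; have := num_words01 n.+1.
rewrite !exceptional_num_words11 !num_words00 !expnS; move: (2 ^ n) IHn => p; nia.
Qed.

(** * From permutations to words *)

(** The relation [r] is the order of the positions, in which [s] is listed. *)
Lemma pair_count_sum (T : eqType) (r R : rel T) s :
    (forall x y, r x y -> r y x = false) -> pairwise r s ->
  pair_count R s = \sum_(x <- s) \sum_(y <- s) (r x y && R x y).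
Proof.
move=> r_asym; elim: s => [|x s IHs]; first by rewrite big_nil.
move=> /andP[/allP rx rs] /=; rewrite big_cons big_cons.
have -> : r x x = false by apply/negP => /[dup]/r_asym->.
congr addn.
  rewrite -sum1_count big_mkcond; apply: eq_big_seq => y /rx->.
  by case: (R x y).
rewrite IHs //; apply: eq_big_seq => y /rx /r_asym ryx.
by rewrite big_cons ryx.
Qed.

Lemma triple_count_sum (T : eqType) (r : rel T) (P : T -> rel T) s :
    (forall x y, r x y -> r y x = false) -> pairwise r s ->
  triple_count P s =
    \sum_(x <- s) \sum_(y <- s) \sum_(z <- s) [&& r x y, r y z & P x y z].
Proof.
move=> r_asym; elim: s => [|x s IHs]; first by rewrite big_nil.
move=> /andP[/allP rx rs] /=; rewrite big_cons big_cons.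
have -> : r x x = false by apply/negP => /[dup]/r_asym->.
rewrite big1 // add0n; congr addn.
  rewrite (pair_count_sum _ r_asym) //; apply: eq_big_seq => y /rx rxy.
  rewrite big_cons (r_asym _ _ rxy) andbF.
  by rewrite rxy.
rewrite IHs //; apply: eq_big_seq => y /rx /r_asym ryx.
rewrite big_cons [X in _ = X + _]big1 => [|z _]; last by rewrite ryx.
apply: eq_big_seq => z /rx /r_asym rzx.
by rewrite big_cons rzx andbF.
Qed.

Definition ffun3 n (t : 'I_n * 'I_n * 'I_n) : {ffun 'I_3 -> 'I_n} :=
  [ffun m : 'I_3 => if m == 0 :> nat then t.1.1
                    else if m == 1 :> nat then t.1.2 else t.2].

Lemma ffun3_bij n : bijective (@ffun3 n).
Proof.
exists (fun f : {ffun 'I_3 -> 'I_n} =>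
  (f ord0, f (lift ord0 ord0), f (lift ord0 (lift ord0 ord0)))).
  by move=> [[i j] k]; rewrite !ffunE.
move=> f; apply/ffunP => -[[|[|[|//]]] m3]; rewrite ffunE /=; congr (f _); exact: val_inj.
Qed.

Lemma forall_ord3 (Q : pred 'I_3) : [forall i, Q i] =
  [&& Q ord0, Q (lift ord0 ord0) & Q (lift ord0 (lift ord0 ord0))].
Proof.
apply/forallP/and3P => [Q_|[Q0 Q1 Q2] i]; first by split.
case: (unliftP ord0 i) => [j|] -> //; case: (unliftP ord0 j) => [k|] -> //.
by rewrite ord1.
Qed.

Lemma card_ord3 (Q : pred 'I_3) : #|[set m | Q m]| =
  Q ord0 + (Q (lift ord0 ord0) + Q (lift ord0 (lift ord0 ord0))).
Proof.
rewrite -sum1dep_card big_mkcond !big_ord_recl big_ord0 /=.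
by do 3!case: (Q _).
Qed.

Lemma word_perm n (p : 'S_n) : perm_eq (word p) (iota 1 n).
Proof.
rewrite /word (map_comp (fun i : 'I_n => i.+1) p).
rewrite -(addn0 1) iotaDl -val_enum_ord -[X in perm_eq _ X]map_comp.
apply: (perm_map (fun i : 'I_n => i.+1)).
apply: uniq_perm; [|exact: enum_uniq|].
  by rewrite (map_inj_uniq (@perm_inj _ p)) enum_uniq.
move=> i; rewrite mem_enum; apply/mapP; exists (p^-1 i)%g.
  by rewrite mem_enum.
by rewrite permKV.
Qed.

Lemma word_inj n : injective (@word n).
Proof.
move=> p q /eq_in_map Epq; apply/permP => i; apply: val_inj.
by apply: succn_inj; apply: Epq; rewrite mem_enum.
Qed.

Lemma card_words n (Q : pred (seq nat)) :
  #|[set p : 'S_n | Q (word p)]| = count Q (permutations (iota 1 n)).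
Proof.
have Uw : uniq [seq word p | p <- enum {: 'S_n}].
  by rewrite map_inj_uniq ?enum_uniq //; apply: word_inj.
have [] := @uniq_min_size _ _ (permutations (iota 1 n)) Uw.
- by move=> _ /mapP[p _ ->]; rewrite mem_permutations word_perm.
- rewrite size_permutations ?iota_uniq // size_iota size_map -cardT.
  by have := card_Sn n; rewrite /= => <-.
move=> _ Ew; rewrite -(seq.permP (uniq_perm Uw (permutations_uniq _) Ew)).
by rewrite count_map cardsE cardE -size_filter enumT.
Qed.

(** [P] only has to agree with the rank condition defining occurrences on distinct
    letters; the summands [1] are the ranks of letters relative to themselves. *)
Lemma occurrences_word n (alpha : 'S_3) (p : 'S_n) P a1 a2 a3 :
    word alpha = [:: a1; a2; a3] ->
    (forall x y z, uniq [:: x; y; z] ->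
      P x y z = [&& 1 + ((y <= x) + (z <= x)) == a1,
                  (x <= y) + (1 + (z <= y)) == a2
                & (x <= z) + ((y <= z) + 1) == a3]) ->
  occurrences alpha p = triple_count P (word p).
Proof.
rewrite /word !enum_ordSl enum_ord0 /= => -[<- <- <-] PE.
rewrite triple_count_map (@triple_count_sum _ (fun i j : 'I_n => i < j)); first last.
- have := iota_ltn_sorted 0 n.
  by rewrite -val_enum_ord (sorted_pairwise ltn_trans) pairwise_map.
- by move=> i j; lia.
pose F (i j k : 'I_n) : nat := [&& i < j, j < k & P (p i).+1 (p j).+1 (p k).+1].
transitivity (\sum_(i < n) \sum_(j < n) \sum_(k < n) F i j k); last first.
  rewrite big_enum; apply: eq_bigr => i _; rewrite big_enum; apply: eq_bigr => j _.
  by rewrite big_enum.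
rewrite (pair_bigA _ (fun i j => \sum_(k < n) F i j k)) /=.
rewrite (pair_bigA _ (fun ij k => F ij.1 ij.2 k)) /=.
rewrite /occurrences -sum1dep_card big_mkcond /= (reindex (@ffun3 n)) /=; last first.
  exact/onW_bij/ffun3_bij.
apply: eq_bigr => -[[i j] k] _ /=.
rewrite /occurrence !forall_ord3 !ffunE /= /F.
case ij: (i < j); last by rewrite ?andbF.
case jk: (j < k); last by rewrite ?andbF.
have ik := ltn_trans ij jk.
rewrite PE; last first.
  by rewrite /= !inE !eqSS !(inj_eq val_inj) !(inj_eq perm_inj) -!val_eqE /=; lia.
rewrite ik !card_ord3 !ffunE /= !ltnS !leqnn.
by case: [&& _, _ & _].
Qed.

Lemma occurrences132 n (p : 'S_n) : occurrences pat132 p = t132 (word p).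
Proof.
apply: (occurrences_word _ word_pat132) => x y z.
by rewrite /= !inE /is132; lia.
Qed.

Lemma occurrences213 n (p : 'S_n) : occurrences pat213 p = t213 (word p).
Proof.
apply: (occurrences_word _ word_pat213) => x y z.
by rewrite /= !inE /is213; lia.
Qed.

(** Reversal exchanges 132 with 231, and likewise 213 with 312. *)
Lemma occurrences231 n (p : 'S_n) :
  occurrences pat231 p = t132 (rev (word p)).
Proof.
rewrite triple_count_rev; apply: (occurrences_word _ word_pat231) => x y z.
by rewrite /= !inE /is132; lia.
Qed.

Lemma occurrences312 n (p : 'S_n) :
  occurrences pat312 p = t213 (rev (word p)).
Proof.
rewrite triple_count_rev; apply: (occurrences_word _ word_pat312) => x y z.
by rewrite /= !inE /is213; lia.
Qed.

Lemma count_rev_permutations (T : eqType) (Q : pred (seq T)) s :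
  count (fun w => Q (rev w)) (permutations s) = count Q (permutations s).
Proof.
rewrite -(count_map rev Q); apply/seq.permP/uniq_perm.
- by rewrite (map_inj_uniq (can_inj revK)) permutations_uniq.
- exact: permutations_uniq.
move=> w; rewrite -[w in LHS]revK (mem_map (can_inj revK)) !mem_permutations.
by rewrite perm_rev.
Qed.

Lemma avoid_once_count_pair n (alpha beta : 'S_3) :
  avoid_once_count n set0 [set alpha; beta] =
  #|[set p : 'S_n | (occurrences alpha p == 1) && (occurrences beta p == 1)]|.
Proof.
apply: eq_card => p; rewrite !inE.
have -> : [forall a in set0, occurrences (a : 'S_3) p == 0].
  by apply/forall_inP => a; rewrite inE.
apply/forall_inP/andP => [Hb|[pa pb] b]; first by rewrite !Hb ?set21 ?set22.
by rewrite !inE => /orP[]/eqP->.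
Qed.

Lemma avoid_once_countE n (alpha beta : 'S_3) :
    [set alpha; beta] \in
      [set [set pat132; pat213]; [set pat231; pat312]] ->
  avoid_once_count n set0 [set alpha; beta] = num_words 1 1 n.
Proof.
rewrite /num_words size_filter !inE => /orP[]/eqP->; rewrite avoid_once_count_pair.
  rewrite -card_words; apply: eq_card => p.
  by rewrite !inE occurrences132 occurrences213.
rewrite -count_rev_permutations -card_words; apply: eq_card => p.
by rewrite !inE occurrences231 occurrences312.
Qed.

Unset Implicit Arguments.
Local Open Scope ring_scope.

Theorem theorem5p3 (alpha beta : 'S_3)
    (Hab : [set alpha; beta] \in
           [set [set pat132; pat213]; [set pat231; pat312]]) :
  [/\ forall n : nat, (7 <= n)%N ->
        (avoid_once_count n set0 [set alpha; beta])%:R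
        = ((n%:R ^+ 2 + 21 * n%:R - 28) * 2 ^ (n%:Z - 9)) :> rat,
      avoid_once_count 6 set0 [set alpha; beta] = 17%N,
      avoid_once_count 5 set0 [set alpha; beta] = 6%N
    & avoid_once_count 4 set0 [set alpha; beta] = 3%N].
Proof.
have countE n := avoid_once_countE n Hab.
have [n4 n5 n6 _] := num_words11_small; split; rewrite ?countE // => n.
move=> /subnK <-; move: (n - 7)%N => m; rewrite countE addnC -[(7 + m)%N]/(m.+3.+4).
have /(congr1 (fun k => k%:R : rat)) := num_words11 m.
rewrite !(natrD, natrM, natrX) => num_m.
have -> : (2 : rat) ^ (Posz m.+3.+4 - 9) = 2 ^+ m / 4.
  rewrite (_ : Posz m.+3.+4 - 9 = Posz m + (- 2%:Z)); last by lia.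
  by rewrite expfzDr // .
apply: (@mulfI _ 4) => //; move: num_m.
move: (num_words _ _ _)%:R (m.+3.+4)%:R (2 ^+ m) => x y z E.
have -> : 4 * x = (4 * x + 28 * z) - 28 * z by ring.
by rewrite E; field.
Qed.
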